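(* Let $K$ be a non-polar compact subset of $\mathbb{R}$, let $\mu_K$ be its equilibrium measure, and let $(a_n)_{n=1}^\infty$ be the sequence of recurrence coefficients for $\mu_K$. If $\liminf_{n\to\infty} a_n=0$, then the sequences $(W_n(\mu_K))_{n=1}^\infty$ and $(M_{n,K})_{n=1}^\infty$ are both unbounded.
   Context: $\mathbb{N}=\{1,2,\dots\}$. $\mathrm{Cap}(\cdot)$ denotes logarithmic capacity; a compact set $K$ is non-polar if $\mathrm{Cap}(K)>0$. For a non-polar compact set $K\subset\mathbb{R}$, $\mu_K$ denotes its equilibrium measure: the unique Borel probability measure on $K$ minimizing the logarithmic energy $\iint \log\frac{1}{|x-y|}\,d\mu(x)\,d\mu(y)$. Let $\mu$ be a unit Borel measure with infinite compact support on $\mathbb{R}$. For $n\in\mathbb{N}$, $P_n(\cdot;\mu)$ is the $n$-th monic orthogonal polynomial for $\mu$, i.e. the monic real polynomial of degree $n$ with minimal $L^2(\mu)$ norm among all monic real polynomials of degree $n$. With $P_{-1}(x;\mu):=0$ and $P_0(x;\mu):=1$, these satisfy $$P_{n+1}(x;\mu)=(x-b_{n+1})P_n(x;\mu)-a_n^2P_{n-1}(x;\mu),\qquad n\in\mathbb{N}\cup\{0\},$$ with $a_n>0$ and $b_n\in\mathbb{R}$; the $a_n$ ($n\ge1$) are the recurrence coefficients for $\mu$ referred to here. One defines $$W_n(\mu):=\frac{\|P_n(\cdot;\mu)\|_{L^2(\mu)}}{\mathrm{Cap}(\mathrm{supp}(\mu))^n}.$$ It holds that $\mathrm{Cap}(\mathrm{supp}(\mu_K))=\mathrm{Cap}(K)$.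 For an infinite compact set $K\subset\mathbb{R}$, the $n$-th Chebyshev polynomial $T_{n,K}$ on $K$ is the monic real polynomial of degree $n$ with minimal sup-norm $\|\cdot\|_{L^\infty(K)}$ on $K$ among all monic real polynomials of degree $n$, and $$M_{n,K}:=\frac{\|T_{n,K}\|_{L^\infty(K)}}{\mathrm{Cap}(K)^n}.$$ *)

(* Defs.v *)
From HB Require Import structures.
From mathcomp Require Import all_boot all_order all_algebra.
From mathcomp Require Import all_classical all_reals all_analysis.

Set Implicit Arguments.
Unset Strict Implicit.
Unset Printing Implicit Defensive.

Import Order.TTheory GRing.Theory Num.Theory.
Import numFieldNormedType.Exports.

Local Open Scope classical_set_scope.
Local Open Scope ring_scope.

Notation borel_probability R := (probability (measurableTypeR R) R).

(* [lne 0 = -oo], so the kernel log (1 / |x - y|) is +oo on the diagonal. *)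
Definition log_energy (R : realType) (mu : borel_probability R) : \bar R :=
  (\int[mu]_y \int[mu]_x (- lne (`|x - y|%:E)))%E.

Definition log_energies_on (R : realType) (K : set R) : set (\bar R) :=
  [set log_energy mu | mu in [set mu : borel_probability R | mu K = 1%E]].

(* Meant for compact K, where the infimum is > -oo; it is +oo exactly when
   every probability measure on K has infinite energy, and then Cap K = 0. *)
Definition Cap (R : realType) (K : set R) : R :=
  fine (expeR (- ereal_inf (log_energies_on K))).

Definition nonpolar (R : realType) (K : set R) : Prop := 0 < Cap K.

Definition is_equilibrium_measure (R : realType) (K : set R)
    (mu : borel_probability R) : Prop :=
  mu K = 1%E /\
  forall nu : borel_probability R, nu K = 1%E ->
    (log_energy mu <= log_energy nu)%E.

Definition measure_support (R : realType) (mu : borel_probability R) : set R :=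
  [set x | forall U : set R, open U -> U x -> (0 < mu U)%E].

Definition monic_of_degree (R : realType) (n : nat) (p : {poly R}) : Prop :=
  p \is monic /\ size p = n.+1.

Definition L2norm (R : realType) (mu : borel_probability R) (p : {poly R})
    : \bar R :=
  ('N[mu]_(2%:E)[EFin \o horner p])%E.

Definition is_orthogonal_poly (R : realType) (mu : borel_probability R)
    (n : nat) (p : {poly R}) : Prop :=
  monic_of_degree n p /\
  forall q : {poly R}, monic_of_degree n q -> (L2norm mu p <= L2norm mu q)%E.

(* The case [n = 0] carries the convention P_{-1} = 0, so [a 0] and [b 0] are
   unconstrained. *)
Definition is_recurrence_coeffs (R : realType) (P : nat -> {poly R})
    (a b : nat -> R) : Prop :=
  (forall n, (0 < n)%N -> 0 < a n) /\
  forall n, P n.+1 = ('X - (b n.+1)%:P) * P n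
                     - a n ^+ 2 *: (if n is m.+1 then P m else 0).

(* W_n(mu), where [P] is the sequence of monic orthogonal polynomials of mu. *)
Definition W (R : realType) (mu : borel_probability R) (P : nat -> {poly R})
    (n : nat) : R :=
  fine (L2norm mu (P n)) / Cap (measure_support mu) ^+ n.

Definition supnorm_on (R : realType) (K : set R) (p : {poly R}) : R :=
  sup [set `|p.[x]| | x in K].

Definition is_chebyshev_poly (R : realType) (K : set R) (n : nat)
    (p : {poly R}) : Prop :=
  monic_of_degree n p /\
  forall q : {poly R}, monic_of_degree n q -> supnorm_on K p <= supnorm_on K q.

(* M_{n,K}, where [T] is the sequence of Chebyshev polynomials on K. *)
Definition M (R : realType) (K : set R) (T : nat -> {poly R}) (n : nat) : R :=
  supnorm_on K (T n) / Cap K ^+ n.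

(* Main.v *)
(** Write U for the potential of the equilibrium measure mu, and I for its
    energy, so that Cap K = exp (- I).  Comparing mu with the normalization of
    mu + s mu|_C for small s > 0 shows that U averages to at most I over every
    Borel set.  Averaging over small balls gives U <= I on the support of mu,
    and convexity of U in the gaps of the support gives U <= I on all of R.
    For a monic p of degree n, Jensen's inequality then yields
    ||p||_2 >= Cap K ^ n, hence W_n >= 1.  Since ||P_n||_2 = a_n ||P_{n-1}||_2,
    this reads W_{n-1} = W_n Cap K / a_n >= Cap K / a_n, which is unbounded when
    liminf a_n = 0; and M_n >= W_n because the L^2 norm of T_n is at most its
    sup norm on K. *)

Require Import Defs.
From HB Require Import structures.
From mathcomp Require Import all_boot all_order all_algebra.
From mathcomp Require Import all_classical all_reals all_analysis.
From mathcomp Require Import measurable_realfun ring lra.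
From mathcomp Require complex.

Set Implicit Arguments.
Unset Strict Implicit.
Unset Printing Implicit Defensive.

Import Order.TTheory GRing.Theory Num.Theory.
Import numFieldNormedType.Exports.

Local Open Scope classical_set_scope.
Local Open Scope ring_scope.

(** * Perturbing a minimizer of the energy of a nonnegative kernel *)

Lemma ge0_le_EFin (R : realDomainType) (x : \bar R) (r : R) :
  (0 <= x -> x <= r%:E -> exists s, x = s%:E)%E.
Proof. by case: x => // s _ _; exists s. Qed.

Section variation.
Local Open Scope ereal_scope.
Context (d : measure_display) (T : measurableType d) (R : realType).

Lemma ge0_integral_mrestr (mu : {measure set T -> \bar R}) (C : set T)
    (mC : measurable C) (f : T -> \bar R) :
  (forall x, 0 <= f x) -> measurable_fun setT f ->
  \int[mrestr mu mC]_x f x = \int[mu]_(x in C) f x.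
Proof.
move=> f0 mf.
rewrite (@ge0_negligible_integral _ T R (mrestr mu mC) setT (~` C))//;
  first last.
- by rewrite /= /mrestr setICl measure0.
- exact: measurableC.
rewrite setDE setTI setCK; apply: eq_measure_integral => A mA AC.
by rewrite /= /mrestr (setIidl AC).
Qed.

Variable mu : probability T R.

Definition overweight (C : set T) (mC : measurable C) (s : {nonneg R}) :
  {measure set T -> \bar R} := measure_add mu (mscale s (mrestr mu mC)).

(** The last argument of [mnormalize] is its fallback for a total mass of 0 or infinity. Here the
    mass is 1 + s mu(C), finite and at least 1, so the fallback is never taken. *)
Definition bump (C : set T) (mC : measurable C) (s : {nonneg R}) :=
  mnormalize (overweight mC s) mu.

HB.instance Definition _ (C : set T) (mC : measurable C) (s : {nonneg R}) :=
  Probability.on (bump mC s).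

Lemma overweightE (C : set T) (mC : measurable C) (s : {nonneg R}) A :
  overweight mC s A = mu A + s%:num%:E * mu (A `&` C).
Proof. exact: measure_addE. Qed.

Lemma overweight_setT (C : set T) (mC : measurable C) (s : {nonneg R}) :
  overweight mC s setT = (1 + s%:num * fine (mu C))%:E.
Proof.
rewrite overweightE setTI probability_setT.
by rewrite -{1}[mu C]fineK ?fin_num_measure.
Qed.

Lemma bumpE (C : set T) (mC : measurable C) (s : {nonneg R}) (A : set T) :
  bump mC s A
  = (mu A + s%:num%:E * mu (A `&` C)) * ((1 + s%:num * fine (mu C))^-1)%:E.
Proof.
rewrite /bump /mnormalize overweight_setT eqe gt_eqF /=; last first.
  by rewrite ltr_pwDl// mulr_ge0// fine_ge0.
by rewrite overweightE.
Qed.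

Lemma ge0_integral_bump (C : set T) (mC : measurable C) (s : {nonneg R})
    (f : T -> \bar R) :
  (forall x, 0 <= f x) -> measurable_fun setT f ->
  \int[bump mC s]_x f x =
  ((1 + s%:num * fine (mu C))^-1)%:E *
  (\int[mu]_x f x + s%:num%:E * \int[mu]_(x in C) f x).
Proof.
move=> f0 mf.
have c0 : (0 <= (1 + s%:num * fine (mu C))^-1)%R.
  by rewrite invr_ge0 addr_ge0// mulr_ge0// fine_ge0.
pose c := NngNum c0.
transitivity (\int[mscale c (overweight mC s)]_x f x).
  apply: eq_measure_integral => A mA _.
  by rewrite /= bumpE muleC /mscale overweightE.
rewrite ge0_integral_mscale// ge0_integral_measure_add//.
by rewrite ge0_integral_mscale// ge0_integral_mrestr.
Qed.

Variable h : T * T -> \bar R.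
Hypothesis h0 : forall p, 0 <= h p.
Hypothesis hsym : forall x y, h (x, y) = h (y, x).
Hypothesis mh : measurable_fun setT h.

Let mhx y : measurable_fun setT (fun x => h (x, y)).
Proof. exact: measurableT_comp mh (measurable_pair2 _). Qed.

Lemma measurable_potential (nu : probability T R) :
  measurable_fun setT (fun y => \int[nu]_x h (x, y)).
Proof. exact: (@measurable_fun_fubini_tonelli_G _ _ _ _ _ nu h). Qed.

(** Moving the restriction from the domain into the kernel makes Tonelli on the full product space
    applicable. *)
Lemma restricted_potentialE (C : set T) : measurable C -> forall y,
  \int[mu]_(x in C) h (x, y) = \int[mu]_x (h \_ (C `*` setT)) (x, y).
Proof.
move=> mC y; rewrite integral_mkcond; apply: eq_integral => x _.
rewrite !patchE; congr (if _ then _ else _).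
by apply/idP/idP; rewrite !inE => //= -[].
Qed.

Let mhC (C : set T) : measurable C -> measurable_fun setT (h \_ (C `*` setT)).
Proof.
move=> mC; apply/(measurable_restrictT _ _).1; first exact: measurableX.
exact: measurable_funTS.
Qed.

Let hC0 (C : set T) p : 0 <= (h \_ (C `*` setT)) p.
Proof. by rewrite patchE; case: ifP. Qed.

Lemma measurable_restricted_potential (C : set T) : measurable C ->
  measurable_fun setT (fun y => \int[mu]_(x in C) h (x, y)).
Proof.
move=> mC; under eq_fun do rewrite restricted_potentialE//.
by apply: (@measurable_fun_fubini_tonelli_G _ _ _ _ _ mu (h \_ (C `*` setT)));
  [exact: mhC|exact: hC0].
Qed.

(** Tonelli for the kernel cut down to [C] times the whole space; the symmetry of [h] then exchanges
    the two variables. *)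
Lemma restricted_potential_swap (C : set T) : measurable C ->
  \int[mu]_y \int[mu]_(x in C) h (x, y)
  = \int[mu]_(y in C) \int[mu]_x h (x, y).
Proof.
move=> mC; under eq_integral do rewrite restricted_potentialE//.
rewrite -(@fubini_tonelli _ _ _ _ _ _ _ (h \_ (C `*` setT))); last 2 first.
- exact: mhC.
- exact: hC0.
rewrite [RHS]integral_mkcond; apply: eq_integral => x _.
rewrite patchE; case: ifPn => xC.
  apply: eq_integral => y _; rewrite patchE hsym ifT// inE; split => //=.
  exact: set_mem.
rewrite integral0_eq// => y _; rewrite patchE ifF//.
by apply/negbTE; apply: contra xC; rewrite !inE => -[].
Qed.

(** By bilinearity the energy is a quadratic polynomial in s over the squared mass. The two cross
    terms agree by [restricted_potential_swap], so the linear coefficient is twice the integral of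
    the potential over [C]. *)
Lemma energy_bump (C : set T) (mC : measurable C) (s : {nonneg R}) :
  \int[bump mC s]_y \int[bump mC s]_x h (x, y) =
  ((1 + s%:num * fine (mu C))^-1)%:E * (((1 + s%:num * fine (mu C))^-1)%:E *
   (\int[mu]_y \int[mu]_x h (x, y)
     + s%:num%:E * (\int[mu]_(y in C) \int[mu]_x h (x, y))
     + s%:num%:E * (\int[mu]_(y in C) \int[mu]_x h (x, y)
         + s%:num%:E * \int[mu]_(y in C) \int[mu]_(x in C) h (x, y)))).
Proof.
set c := (_^-1)%R.
have c0 : (0 <= c)%R by rewrite invr_ge0 addr_ge0// mulr_ge0// fine_ge0.
have U0 (nu : probability T R) y : 0 <= \int[nu]_x h (x, y).
  by apply: integral_ge0 => x _; exact: h0.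
have V0 y : 0 <= \int[mu]_(x in C) h (x, y).
  by apply: integral_ge0 => x _; exact: h0.
have mU := measurable_potential mu.
have mV := measurable_restricted_potential mC.
under eq_integral do rewrite ge0_integral_bump//.
rewrite -/c.
have e0 y : 0 <= \int[mu]_x h (x, y) + s%:num%:E * \int[mu]_(x in C) h (x, y).
  by rewrite adde_ge0// mule_ge0.
have m1 : measurable_fun setT (fun y => \int[mu]_x h (x, y) +
    s%:num%:E * \int[mu]_(x in C) h (x, y)).
  apply: emeasurable_funD => //; exact: measurable_funeM.
rewrite ge0_integral_bump//; last 2 first.
- by move=> y; rewrite mule_ge0.
- exact: measurable_funeM.
rewrite -/c; congr (_ * _).
rewrite ge0_integralZl// ge0_integralZl//; last exact: measurable_funTS.
rewrite muleCA -ge0_muleDr//; last 2 first.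
- by apply: integral_ge0.
- by rewrite mule_ge0//; apply: integral_ge0.
congr (_ * _).
have intD (D : set T) : measurable D ->
    \int[mu]_(y in D) (\int[mu]_x h (x, y) +
                        s%:num%:E * \int[mu]_(x in C) h (x, y))
    = \int[mu]_(y in D) \int[mu]_x h (x, y)
      + s%:num%:E * \int[mu]_(y in D) \int[mu]_(x in C) h (x, y).
  move=> mD; rewrite (ge0_integralD _ mD)//.
  - rewrite (ge0_integralZl _ mD)//; exact: measurable_funTS.
  - exact: measurable_funTS.
  - by move=> y _; rewrite mule_ge0.
  - by apply: measurable_funeM; exact: measurable_funTS.
rewrite (intD _ measurableT) (intD _ mC).
rewrite (restricted_potential_swap mC).
by congr (_ + _ * _ + _ * (_ + _ * _)).
Qed.

Variable e : R.
Hypothesis Ee : \int[mu]_y \int[mu]_x h (x, y) = e%:E.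
Variable K : set T.
Hypothesis mK : measurable K.
Hypothesis muK : mu K = 1.
Hypothesis mu_min : forall nu : probability T R, nu K = 1 ->
  e%:E <= \int[nu]_y \int[nu]_x h (x, y).

Lemma bump_carrier (C : set T) (mC : measurable C) (s : {nonneg R}) :
  bump mC s K = 1.
Proof.
have KC : mu (K `&` C) = mu C.
  rewrite setIC; apply/eqP; rewrite eq_le; apply/andP; split.
    by apply: le_measure; rewrite ?inE//; exact: measurableI.
  rewrite -[X in mu X <= _](setIT C) -(setUv K) setIUr.
  have K'0 : mu (C `&` ~` K) = 0.
    apply: (@subset_measure0 _ _ _ _ _ (~` K)) => //.
    - by apply: measurableI => //; exact: measurableC.
    - exact: measurableC.
    - by rewrite [LHS]probability_setC// muK subee.
  rewrite measureU0//; first exact: measurableI.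
  by apply: measurableI => //; exact: measurableC.
rewrite bumpE KC muK.
rewrite (_ : 1 + _ = (1 + s%:num * fine (mu C))%:E); last first.
  by rewrite EFinD EFinM fineK ?fin_num_measure.
by rewrite -EFinM divff// gt_eqF// ltr_pwDl// mulr_ge0// fine_ge0.
Qed.

(** First variation: the energy of the perturbed measure cannot fall below e for small s > 0, so its
    derivative at s = 0, which is 2 (B - e mu(C)), is nonnegative. *)
Lemma integral_potential_ge (C : set T) : measurable C ->
  e%:E * mu C <= \int[mu]_(y in C) \int[mu]_x h (x, y).
Proof.
move=> mC.
have U0 y : 0 <= \int[mu]_x h (x, y).
  by apply: integral_ge0 => x _; exact: h0.
have V0 y : 0 <= \int[mu]_(x in C) h (x, y).
  by apply: integral_ge0 => x _; exact: h0.
have mU := measurable_potential mu.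
have mV := measurable_restricted_potential mC.
have e0 : (0 <= e)%R by rewrite -lee_fin -Ee; exact: integral_ge0.
set B := integral _ _ _.
have B0 : 0 <= B by exact: integral_ge0.
have Be : B <= e%:E.
  by rewrite -Ee; apply: ge0_subset_integral.
pose D := \int[mu]_(y in C) \int[mu]_(x in C) h (x, y).
have D0 : 0 <= D by exact: integral_ge0.
have DB : D <= B.
  apply: ge0_le_integral => //.
  - exact: measurable_funTS.
  - exact: measurable_funTS.
  - by move=> y _; apply: ge0_subset_integral.
have mCE : mu C = (fine (mu C))%:E by rewrite fineK// fin_num_measure.
have m0 : (0 <= fine (mu C))%R by rewrite fine_ge0.
have [b BE] : exists b : R, B = b%:E by exact: ge0_le_EFin B0 Be.
have [dd DE] : exists b : R, D = b%:E by exact: ge0_le_EFin D0 (le_trans DB Be).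
(* Minimality against the perturbed measure, with the squared mass multiplied out. *)
have key (s : R) : (0 <= s)%R ->
  (e * (1 + s * fine (mu C)) ^+ 2 <= e + s * b + s * (b + s * dd))%R.
  move=> s0; have := mu_min (bump_carrier mC (NngNum s0)).
  rewrite energy_bump Ee -/B -/D BE DE.
  set c := ((1 + _)^-1)%R.
  rewrite -[X in _ <= X]/((c * (c * (e + s * b + s * (b + s * dd))))%:E).
  have c0 : (0 < 1 + s * fine (mu C))%R by rewrite ltr_pwDl// mulr_ge0.
  by rewrite lee_fin mulrA -invfM -expr2 mulrC ler_pdivlMr// exprn_gt0.
rewrite BE mCE -EFinM lee_fin leNgt; apply/negP => Blt.
move: D0 B0; rewrite BE DE !lee_fin => d0 b0.
move: (fine (mu C)) m0 key Blt => m m0 key; rewrite -subr_gt0 => g0.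
have d1 : (0 < dd + 1)%R by lra.
(* If the gap g = e m - b were positive, this s would give s dd < g, so the gain 2 g of first order
   would beat the quadratic term s dd. Dividing by dd + 1 covers the case dd = 0. *)
pose s := ((e * m - b) / (dd + 1))%R.
have s0 : (0 < s)%R by rewrite divr_gt0.
have sd : (s * (dd + 1) = e * m - b)%R by rewrite divfK// gt_eqF.
have := key s (ltW s0).
have : (0 <= e * m ^+ 2)%R by rewrite mulr_ge0// exprn_ge0.
move: sd s0; clearbody s; move=> sd s0 em key1.
have : (s * (2 * (e * m - b) + s * (e * m ^+ 2) - s * dd) <= 0)%R.
  by nra.
rewrite pmulr_rle0// => h1.
have : (0 <= s * (e * m ^+ 2))%R by rewrite mulr_ge0// ltW.
nra.
Qed.

(** The lower bound on the complement of [C] leaves at most this much for [C], since the integral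
    over the whole space is exactly e. *)
Lemma integral_potential_le (C : set T) : measurable C ->
  \int[mu]_(y in C) \int[mu]_x h (x, y) <= e%:E * mu C.
Proof.
move=> mC.
have U0 y : 0 <= \int[mu]_x h (x, y).
  by apply: integral_ge0 => x _; exact: h0.
have mU := measurable_potential mu.
have := integral_potential_ge (measurableC mC).
rewrite probability_setC//.
set B' := integral mu (~` C) _; set B := integral mu C _.
have B0 : 0 <= B by exact: integral_ge0.
have B'0 : 0 <= B' by exact: integral_ge0.
have : B' + B = e%:E.
  rewrite -Ee -ge0_integral_setU//.
  - by rewrite setvU.
  - exact: measurableC.
  - by rewrite setvU.
  - by apply/disj_setPS => x [].
have -> : mu C = (fine (mu C))%:E by rewrite fineK// fin_num_measure.
clearbody B B'; case: B B0 => [b||]//; case: B' B'0 => [b'||]//= _ _ -[E].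
change ((e * (1 - fine (mu C)))%:E <= b'%:E -> b%:E <= (e * fine (mu C))%:E).
by rewrite !lee_fin; nra.
Qed.

End variation.

(** * The truncated logarithmic kernel *)

Section carrier.
Local Open Scope ereal_scope.
Context (d : measure_display) (T : measurableType d) (R : realType).
Variable P : probability T R.

Lemma ae_carrier (S : set T) (Q : T -> Prop) : measurable S -> P S = 1 ->
  (forall x, S x -> Q x) -> {ae P, forall x, Q x}.
Proof.
move=> mS PS SQ; exists (~` S); split; first exact: measurableC.
  by rewrite [LHS]probability_setC// PS subee.
by apply: subsetC => x /SQ.
Qed.

Lemma ge0_le_integral_carrier (S : set T) (f g : T -> \bar R) :
  measurable S -> P S = 1 -> (forall x, 0 <= f x) -> (forall x, 0 <= g x) ->
  measurable_fun setT f -> measurable_fun setT g ->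
  (forall x, S x -> f x <= g x) -> \int[P]_x f x <= \int[P]_x g x.
Proof.
move=> mS PS f0 g0 mf mg fg; apply: ae_ge0_le_integral => //.
by apply: (ae_carrier mS PS) => x Sx _; exact: fg.
Qed.

Lemma integral_probability_cst (r : R) : \int[P]_x r%:E = r%:E.
Proof. by rewrite integral_cst// [X in _ * X]probability_setT mule1. Qed.

(* [integralB] does not apply since [f] may have infinite integral. *)
Lemma integral_subr_cst (f : T -> \bar R) (c : R) : (0 <= c)%R ->
  (forall x, 0 <= f x) -> measurable_fun setT f ->
  \int[P]_x (f x - c%:E) = \int[P]_x f x - c%:E.
Proof.
move=> c0 f0 mf; pose g x := f x - c%:E.
have mg : measurable_fun setT g by apply: emeasurable_funB.
have gneg_le x : g^\- x <= c%:E.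
  rewrite funenegE ge_max lee_fin c0 andbT /g.
  have := f0 x; case: (f x) => [r||]//; rewrite ?leNye// => r0.
  rewrite -[leLHS]/((- (r - c))%:E) lee_fin.
  by move: r0; rewrite lee_fin; lra.
have Neg0 : 0 <= \int[P]_x g^\- x by apply: integral_ge0.
have NegE : \int[P]_x g^\- x <= c%:E.
  rewrite -[leRHS]integral_probability_cst; apply: ge0_le_integral => //.
  exact: measurable_funeneg.
(* With g = f - c, the identity g^+ + c = f + g^- has only nonnegative terms, so it integrates
   additively even when f has infinite integral; g^- is at most c and can be subtracted
   afterwards. *)
have : \int[P]_x g^\+ x + c%:E = \int[P]_x f x + \int[P]_x g^\- x.
  rewrite -[X in _ + X]integral_probability_cst -!ge0_integralD//.
  - apply: eq_integral => x _; rewrite funeposE funenegE /g.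
    have := f0 x; case: (f x) => [r||]// r0.
      rewrite -[r%:E - c%:E]/((r - c)%:E) -[- _]/((- (r - c))%:E).
      have [h|h] := leP 0%R (r - c)%R.
        rewrite (@max_l _ _ (r - c)%:E) ?lee_fin// max_r ?lee_fin ?oppr_le0//.
        by rewrite adde0 -EFinD subrK.
      rewrite (@max_r _ _ (r - c)%:E) ?lee_fin ?ltW//.
      rewrite max_l ?lee_fin ?oppr_ge0 ?ltW// add0e -EFinD.
      by congr EFin; lra.
    by rewrite maxye// addye// maxNye.
  - exact: measurable_funeneg.
  - exact: measurable_funepos.
move=> E0; rewrite [LHS]integralE -/g; move: E0.
have [n ->] := ge0_le_EFin Neg0 NegE.
have : 0 <= \int[P]_x g^\+ x by apply: integral_ge0.
have : 0 <= \int[P]_x f x by apply: integral_ge0.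
set A := integral _ _ _; set B := integral _ _ _.
case: A => [a||]//; case: B => [b||]//= _ _.
by rewrite -!EFinD => -[E]; congr EFin; lra.
Qed.

End carrier.

Section logarithmic_kernel.
Context (R : realType).
Implicit Types (D x y z : R) (mu : borel_probability R).

(* A nonnegative kernel which agrees with [ln (D / |x - y|)] at points at
   distance at most D. *)
Definition logker D x y : \bar R :=
  if x == y then +oo%E else (Num.max (ln D - ln `|x - y|) 0)%:E.

Lemma logker_ge0 D x y : (0 <= logker D x y)%E.
Proof.
by rewrite /logker; case: ifP => // _; rewrite lee_fin le_max lexx orbT.
Qed.

Lemma logkerC D x y : logker D x y = logker D y x.
Proof. by rewrite /logker eq_sym distrC. Qed.

Lemma measurable_logker D : measurable_fun setT
  (fun p : measurableTypeR R * measurableTypeR R => logker D p.1 p.2).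
Proof.
apply: measurable_fun_ifT => //; first exact: measurable_fun_eqr.
apply/measurable_EFinP; apply: measurable_maxr => //.
apply: measurable_funB => //.
by apply: measurableT_comp => //; apply: measurableT_comp => //;
  exact: measurable_funB.
Qed.

Lemma measurable_lne_dist : measurable_fun setT
  (fun p : measurableTypeR R * measurableTypeR R => (- lne `|p.1 - p.2|%:E)%E).
Proof.
apply: measurableT_comp => //; rewrite /lne.
have md : measurable_fun setT
    (fun p : measurableTypeR R * measurableTypeR R => `|p.1 - p.2|).
  by apply: measurableT_comp => //; exact: measurable_funB.
apply: measurable_fun_ifT => //; first exact: measurable_fun_ler.
by apply/measurable_EFinP; exact: measurableT_comp.
Qed.

Lemma measurable_logkerl D y :
  measurable_fun setT (fun x : measurableTypeR R => logker D x y).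
Proof. exact: measurableT_comp (measurable_logker D) (measurable_pair2 _). Qed.

Lemma lne_dist_logker D x y : 0 < D -> `|x - y| <= D ->
  (- lne `|x - y|%:E = logker D x y - (ln D)%:E)%E.
Proof.
move=> D0 xyD; rewrite /logker; case: eqP => [->|/eqP xy].
  by rewrite subrr normr0 le0_lneNy.
have d0 : 0 < `|x - y| by rewrite normr_gt0 subr_eq0.
rewrite lne_EFin// max_l ?subr_ge0 ?ler_ln// -EFinN -EFinB.
by congr EFin; lra.
Qed.

(** At a point [y] within distance [D] of mu-almost every point, this is the logarithmic potential
    of [mu] shifted by ln D. *)
Definition logpot D mu y : \bar R := (\int[mu]_x logker D x y)%E.

Lemma logpot_ge0 D mu y : (0 <= logpot D mu y)%E.
Proof. by apply: integral_ge0 => x _; exact: logker_ge0. Qed.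

Lemma measurable_logpot D mu :
  measurable_fun setT (logpot D mu : measurableTypeR R -> \bar R).
Proof.
have h0 (p : measurableTypeR R * measurableTypeR R) :
  (0 <= logker D p.1 p.2)%E by exact: logker_ge0.
exact: (measurable_potential h0 (measurable_logker D) mu).
Qed.

(** The shift by ln D trades the signed logarithmic kernel for a nonnegative one without changing
    which measures on [K] are minimizers, so the variational argument applies. *)
Lemma log_energy_logpot D mu (K : set R) : 1 <= D ->
  measurable (K : set (measurableTypeR R)) -> mu K = 1%E ->
  (forall x y, K x -> K y -> `|x - y| <= D) ->
  log_energy mu = (\int[mu]_y logpot D mu y - (ln D)%:E)%E.
Proof.
move=> D1 mK muK KD.
have D0 : 0 < D by exact: lt_le_trans D1.
rewrite /log_energy.
rewrite -integral_subr_cst ?ln_ge0//; first last.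
- exact: measurable_logpot.
- exact: logpot_ge0.
apply: ae_eq_integral => //.
- pose h (p : measurableTypeR R * measurableTypeR R) :=
    (- lne `|p.1 - p.2|%:E)%E.
  have mh : measurable_fun setT h by exact: measurable_lne_dist.
  (* The kernel is signed here, so measurability of the inner integral comes from its positive and
     negative parts separately. *)
  rewrite (_ : (fun _ => _) = (fun y =>
      \int[mu]_x h^\+ (x, y) - \int[mu]_x h^\- (x, y))%E).
    apply: emeasurable_funB.
    + have h0 p : (0 <= h^\+ p)%E by [].
      exact: (measurable_potential h0 (measurable_funepos mh) mu).
    + have h0 p : (0 <= h^\- p)%E by [].
      exact: (measurable_potential h0 (measurable_funeneg mh) mu).
  apply/funext => y; rewrite integralE.
  by congr (_ - _)%E; apply: eq_integral => x _; rewrite ?funeposE ?funenegE.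
- by apply: emeasurable_funB => //; exact: measurable_logpot.
- apply: (ae_carrier mK muK) => y Ky _.
  rewrite -integral_subr_cst ?ln_ge0//; first last.
  + exact: measurable_logkerl.
  + by move=> x; exact: logker_ge0.
  apply: ae_eq_integral => //.
  + exact: measurableT_comp measurable_lne_dist (measurable_pair2 _).
  + by apply: emeasurable_funB => //; exact: measurable_logkerl.
  + by apply: (ae_carrier mK muK) => x Kx _;
    rewrite (lne_dist_logker D0 (KD _ _ Kx Ky)).
Qed.

End logarithmic_kernel.

(** * Bounding the equilibrium potential *)

Section support.
Context (R : realType).
Variable mu : borel_probability R.

Lemma measure_support_closed : closed (measure_support mu).
Proof.
rewrite -[measure_support mu]setCK; apply: open_closedC.
rewrite openE => x /existsNP[U /not_implyP[oU /not_implyP[Ux muU]]].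
apply: filterS (open_nbhs_nbhs (conj oU Ux)) => y Uy Sy.
by apply: muU; exact: Sy.
Qed.

Lemma measurable_measure_support :
  measurable (measure_support mu : set (measurableTypeR R)).
Proof. exact: closed_measurable measure_support_closed. Qed.

Lemma measure_support_sub (K : set R) : closed K -> mu K = 1%E ->
  measure_support mu `<=` K.
Proof.
move=> cK muK x Sx; apply: contrapT => Kx.
have := Sx (~` K) (closed_openC cK) Kx.
by rewrite probability_setC ?muK ?subee ?ltxx//; exact: closed_measurable.
Qed.

(* The complement of the support is covered by the countably many null
   intervals with rational endpoints. *)
Lemma measure_support1 : mu (measure_support mu) = 1%E.
Proof.
(* Pairs of rationals are enumerated through [unpickle]; intervals of positive measure are replaced
   by [set0], so every [J n] is null. *)
pose J (n : nat) : set (measurableTypeR R) :=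
  if @unpickle (rat * rat)%type n is Some q then
    let A := `](ratr q.1 : R), ratr q.2[%classic in
    if mu A == 0%E then A else set0
  else set0.
have mJ n : measurable (J n).
  by rewrite /J; case: unpickle => // q; case: ifP.
have J0 n : mu (J n) = 0%E.
  by rewrite /J; case: unpickle => [q|] //; case: ifP => // /eqP.
have cover : ~` measure_support mu `<=` \bigcup_n J n.
  move=> x /existsNP[U /not_implyP[oU /not_implyP[Ux muU]]].
  have [e /= e0 eU] : nbhs_ball x U.
    by apply/nbhs_ballP; exact: open_nbhs_nbhs.
  have [p] := @rat_in_itvoo R (x - e) x ltac:(lra).
  have [q] := @rat_in_itvoo R x (x + e) ltac:(lra).
  rewrite !in_itv /= => /andP[q1 q2] /andP[p1 p2].
  exists (pickle (p, q)); first exact: I.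
  rewrite /J pickleK; cbv zeta.
  rewrite ifT; first by rewrite /= in_itv /= p2 q1.
  rewrite eq_le measure_ge0 andbT.
  have : (mu U <= 0)%E by rewrite leNgt; apply/negP.
  apply: le_trans; apply: le_measure; rewrite ?inE//.
    exact: open_measurable.
  move=> y /=; rewrite in_itv/= => /andP[y1 y2]; apply: eU.
  by rewrite /ball /= ltr_distlC; apply/andP; split; lra.
have mS' := measurableC measurable_measure_support.
have S'0 : mu (~` measure_support mu) = 0%E.
  apply/eqP; rewrite eq_le measure_ge0 andbT.
  have mU : measurable (\bigcup_n J n) by exact: bigcupT_measurable.
  apply: (@le_trans _ _ (mu (\bigcup_n J n))).
    by apply: le_measure; rewrite ?inE.
  apply: le_trans (measure_sigma_subadditive _ mJ mU (@subset_refl _ _)) _.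
  by rewrite eseries0// => n _ _; exact: J0.
have := probability_setC mu mS'.
by rewrite setCK S'0 sube0.
Qed.

End support.

Lemma closed_sup (R : realType) (A : set R) :
  closed A -> A !=set0 -> has_ubound A -> A (sup A).
Proof.
by move=> cA A0 uA; have := closure_sup A0 uA; rewrite -(closure_id A).1.
Qed.

Lemma closed_inf (R : realType) (A : set R) :
  closed A -> A !=set0 -> has_lbound A -> A (inf A).
Proof.
move=> cA A0 lA.
have cNA : closed (-%R @` A).
  rewrite (_ : -%R @` A = -%R @^-1` A); last first.
    apply/seteqP; split => [_ [x Ax <-] /=|x /= Ax]; first by rewrite opprK.
    by exists (- x); rewrite ?opprK.
  by apply: closed_comp => // x _; exact: opp_continuous.
have [x Ax xE] := closed_sup cNA ((nonemptyN A).2 A0) ((has_lb_ubN A).1 lA).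
by rewrite /inf -xE opprK.
Qed.

(** * The potential on the support, by averaging over shrinking balls *)

Section equilibrium_potential.
Local Open Scope ereal_scope.
Context (R : realType).
Variables (mu : borel_probability R) (K : set R) (D e : R).
Hypothesis mK : measurable (K : set (measurableTypeR R)).
Hypothesis muK : mu K = 1.
Hypothesis Ee : \int[mu]_y logpot D mu y = e%:E.
Hypothesis mu_min : forall nu : borel_probability R, nu K = 1 ->
  e%:E <= \int[nu]_y logpot D nu y.

Lemma integral_logpot_le (B : set (measurableTypeR R)) : measurable B ->
  \int[mu]_(y in B) logpot D mu y <= e%:E * mu B.
Proof.
have h0 (p : measurableTypeR R * measurableTypeR R) : 0 <= logker D p.1 p.2.
  exact: logker_ge0.
exact: (integral_potential_le h0 (fun x y => logkerC D x y)
  (measurable_logker D) Ee mK muK mu_min).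
Qed.

(** The number |x - z| + r is the largest distance from x to the closed ball of radius r about z.
    This finite kernel thus bounds [logker D x y] from below for all y in that ball. *)
Definition regker (z r x : R) : R :=
  (Num.max (ln D - ln (`|x - z| + r)) 0)%R.

Lemma regker_ge0 z r x : (0 <= regker z r x)%R.
Proof. by rewrite le_max lexx orbT. Qed.

Lemma measurable_regker z r :
  measurable_fun setT (fun x : measurableTypeR R => (regker z r x)%:E).
Proof.
apply/measurable_EFinP; apply: measurable_maxr => //.
apply: measurable_funB => //; apply: measurableT_comp => //.
apply: measurable_funD => //; apply: measurableT_comp => //.
exact: measurable_funB.
Qed.

Lemma ler_max0 (a b : R) : (a <= b)%R -> (Num.max a 0 <= Num.max b 0)%R.
Proof. by move=> ab; rewrite ge_max !le_max ab lexx orbT. Qed.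

Lemma regker_le_logker z r x y : (`|y - z| <= r)%R ->
  (regker z r x)%:E <= logker D x y.
Proof.
move=> yz; rewrite /logker; case: eqP => [_|/eqP xy]; first by rewrite leey.
have d0 : (0 < `|x - y|)%R by rewrite normr_gt0 subr_eq0.
have dr : (`|x - y| <= `|x - z| + r)%R.
  rewrite (le_trans _ (lerD (lexx _) yz))// (distrC y).
  by rewrite (_ : x - y = (x - z) + (z - y))%R ?ler_normD//; ring.
rewrite lee_fin ler_max0// lerD2l lerN2 ler_ln//.
by rewrite posrE (lt_le_trans d0).
Qed.

Lemma logker_le_sup_regker z x :
  logker D x z <= ereal_sup (range (fun n => (regker z n.+1%:R^-1 x)%:E)).
Proof.
set s := ereal_sup _.
have sub n : (regker z n.+1%:R^-1 x)%:E <= s.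
  by apply: ereal_sup_ubound; exists n.
have small (t : R) : (0 < t)%R -> exists n : nat, (n.+1%:R^-1 < t)%R.
  move=> t0; have [N _ /(_ N (leqnn N)) h] := near_infty_natSinv_lt (PosNum t0).
  by exists N.
rewrite /logker; case: eqP => [xz|/eqP xz].
  rewrite leye_eq; apply/eqP/eqyP => A _.
  (* On the diagonal the regularized kernel is at least ln D - ln r, which exceeds A once r < exp
     (ln D - A). *)
  have [n nA] := small _ (expR_gt0 (ln D - A)).
  apply: le_trans (sub n); rewrite lee_fin /regker xz subrr normr0 add0r.
  rewrite le_max; apply/orP; left.
  have : (ln (n.+1%:R^-1) < ln D - A)%R.
    by rewrite -[ltRHS]expRK ltr_ln ?posrE ?expR_gt0// invr_gt0.
  lra.
have d0 : (0 < `|x - z|)%R by rewrite normr_gt0 subr_eq0.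
apply/lee_addgt0Pr => t t0.
(* Off the diagonal, ln (|x - z| + r) exceeds ln |x - z| by at most r / |x - z|, which is below t
   for this n. *)
have [n nt] := small _ (mulr_gt0 d0 t0).
apply: le_trans (leeD2r _ (sub n)); rewrite -EFinD lee_fin.
set r := (n.+1%:R^-1)%R in nt *.
have r0 : (0 < r)%R by rewrite invr_gt0.
have : (ln (`|x - z| + r) <= ln `|x - z| + t)%R.
  rewrite (_ : `|x - z| + r = `|x - z| * (1 + r / `|x - z|))%R; last first.
    by rewrite mulrDr mulr1 mulrC divfK// gt_eqF.
  have q0 : (0 < r / `|x - z|)%R by rewrite divr_gt0.
  rewrite lnM ?posrE// ?addr_gt0// lerD2l.
  rewrite (le_trans (le_ln1Dx _))//; first lra.
  by rewrite ler_pdivrMr// mulrC ltW.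
rewrite /regker => h.
rewrite ge_max; apply/andP; split.
  by rewrite -lerBlDr le_max; apply/orP; left; lra.
by apply: addr_ge0; [exact: regker_ge0|exact: ltW].
Qed.

(** The left side is a constant below the potential on the whole ball B, so its product with mu(B)
    is at most e mu(B); membership of z in the support allows division by mu(B). *)
Lemma integral_regker_le z r : measure_support mu z -> (0 < r)%R ->
  \int[mu]_x (regker z r x)%:E <= e%:E.
Proof.
move=> Sz r0; pose B : set (measurableTypeR R) := ball z r.
have mB : measurable B by apply: open_measurable; exact: ball_open.
have muB : 0 < mu B by apply: Sz; [exact: ball_open|exact: ballxx].
have mg := measurable_regker z r.
have g0 : 0 <= \int[mu]_x (regker z r x)%:E.
  by apply: integral_ge0 => x _; rewrite lee_fin regker_ge0.
have : (\int[mu]_x (regker z r x)%:E) * mu B <= e%:E * mu B.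
  apply: le_trans (integral_logpot_le mB).
  rewrite -integral_cst//; apply: ge0_le_integral => //.
  - exact: measurable_funTS (measurable_logpot _ _).
  - move=> y By; apply: ge0_le_integral => //.
    + by move=> x _; rewrite lee_fin regker_ge0.
    + exact: measurable_logkerl.
    + move=> x _; apply: regker_le_logker.
      by rewrite distrC ltW.
have -> : mu B = (fine (mu B))%:E by rewrite fineK// fin_num_measure.
by rewrite lee_pmul2r// lte_fin fine_gt0// muB /= ltey_eq fin_num_measure.
Qed.

(** The regularized kernels increase to [logker] as the radius 1 / (n + 1) shrinks, so monotone
    convergence carries the bound to the limit. *)
Lemma logpot_le_support z : measure_support mu z -> logpot D mu z <= e%:E.
Proof.
move=> Sz; pose g n x : \bar R := (regker z n.+1%:R^-1 x)%:E.
have ndg x : nondecreasing_seq (g ^~ x).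
  apply/nondecreasing_seqP => n; rewrite lee_fin ler_max0// lerD2l lerN2.
  rewrite ler_ln ?posrE ?ltr_wpDl ?invr_gt0// lerD2l lef_pV2 ?posrE//.
  by rewrite ler_nat.
rewrite /logpot.
have -> : \int[mu]_x logker D x z = limn (fun n => \int[mu]_x g n x).
  rewrite -monotone_convergence//.
  - apply: eq_integral => x _.
    rewrite (cvg_lim _ (ereal_nondecreasing_cvgn (ndg x)))//.
    apply/eqP; rewrite eq_le logker_le_sup_regker /=.
    apply: ge_ereal_sup => _ [n _ <-]; apply: regker_le_logker.
    by rewrite subrr normr0 invr_ge0.
  - by move=> n; exact: measurable_regker.
  - by move=> n x _; rewrite lee_fin regker_ge0.
apply: lime_le.
  apply: ereal_nondecreasing_is_cvgn => m n mn; apply: ge0_le_integral => //.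
  - by move=> x _; rewrite lee_fin regker_ge0.
  - exact: measurable_regker.
  - exact: measurable_regker.
  - by move=> x _; exact: ndg.
by apply: nearW => n; apply: integral_regker_le.
Qed.

End equilibrium_potential.

(** * Convexity of the kernel and gaps of the support *)

(** As x is not strictly between u and v, the distance to x is affine on [u, v]; concavity of ln
    makes -ln of it convex, and a maximum with 0 preserves convexity. *)
Lemma logker_convex (R : realType) (D t u v x : R) :
  0 < t -> t < 1 -> u < v -> x <= u \/ v <= x ->
  (logker D x (t * u + (1 - t) * v)
   <= t%:E * logker D x u + (1 - t)%:E * logker D x v)%E.
Proof.
move=> t0 t1 uv xuv; have t1' : 0 < 1 - t by lra.
have nn s y : 0 < s -> (0 <= s%:E * logker D x y)%E.
  by move=> s0; rewrite mule_ge0 ?logker_ge0// lee_fin ltW.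
have [xu|xu] := eqVneq x u.
  rewrite {2}/logker xu eqxx gt0_muley ?lte_fin// addye ?leey// -xu.
  by rewrite gt_eqF// (lt_le_trans _ (nn _ _ t1')).
have [xv|xv] := eqVneq x v.
  rewrite {3}/logker xv eqxx gt0_muley ?lte_fin// addey ?leey// -xv.
  by rewrite gt_eqF// (lt_le_trans _ (nn _ _ t0)).
set z := t * u + (1 - t) * v.
have zu : u < z by rewrite /z; nra.
have zv : z < v by rewrite /z; nra.
have xz : x != z by apply/eqP => xz; case: xuv; lra.
rewrite /logker (negbTE xu) (negbTE xv) (negbTE xz) -!EFinM -EFinD lee_fin.
have a0 : 0 < `|x - u| by rewrite normr_gt0 subr_eq0.
have b0 : 0 < `|x - v| by rewrite normr_gt0 subr_eq0.
have c0 : 0 < `|x - z| by rewrite normr_gt0 subr_eq0.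
have cE : `|x - z| = t * `|x - u| + (1 - t) * `|x - v|.
  case: xuv => h.
    by rewrite !ler0_norm /z; nra.
  by rewrite !ger0_norm /z; nra.
move: a0 b0 c0 cE; move: `|x - u| `|x - v| `|x - z| => a b c a0 b0 c0 cE.
(* The tangent line of ln at c. Weighting it at a and b cancels the linear terms, because c is their
   weighted mean. *)
have tangent y : 0 < y -> ln y <= ln c + (y / c - 1).
  move=> y0; have yc0 : 0 < y / c by rewrite divr_gt0.
  rewrite -lerBlDl -ln_div// (_ : y / c = 1 + (y / c - 1)); last lra.
  by rewrite [X in _ <= X]addrAC subrr add0r le_ln1Dx//; lra.
have : t * ln a + (1 - t) * ln b <= ln c.
  have ha := tangent _ a0; have hb := tangent _ b0.
  have hc : t * (a / c) + (1 - t) * (b / c) = 1.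
    by rewrite !mulrA -mulrDl -cE divff// gt_eqF.
  nra.
have max_ge (y : R) : y <= Num.max y 0 /\ 0 <= Num.max y 0.
  by rewrite !le_max !lexx orbT.
have [ha1 ha0] := max_ge (ln D - ln a); have [hb1 hb0] := max_ge (ln D - ln b).
by move=> h; rewrite ge_max; apply/andP; split; nra.
Qed.

Lemma logker_dist_le (R : realType) (D x y z : R) :
  `|x - y| <= `|x - z| -> (logker D x z <= logker D x y)%E.
Proof.
move=> xyz; rewrite {2}/logker; case: eqP => [_|/eqP xy]; first by rewrite leey.
have d0 : 0 < `|x - y| by rewrite normr_gt0 subr_eq0.
rewrite /logker -subr_eq0 -normr_eq0 gt_eqF ?(lt_le_trans d0)//.
rewrite lee_fin ler_max0// lerD2l lerN2 ler_ln//.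
by rewrite posrE (lt_le_trans d0).
Qed.

(* In a gap of the support the potential is convex, so the bound on the support
   propagates to the whole line. *)
Lemma logpot_le_line (R : realType) (mu : borel_probability R) (D e : R) :
  (forall z, measure_support mu z -> (logpot D mu z <= e%:E)%E) ->
  forall z, (logpot D mu z <= e%:E)%E.
Proof.
move=> Se z; set S := measure_support mu.
have cS : closed S by exact: measure_support_closed.
have mS : measurable (S : set (measurableTypeR R)).
  exact: measurable_measure_support.
have muS : mu S = 1%E by exact: measure_support1.
have [Sz|Sz] := pselect (S z); first exact: Se.
(* This settles a z lying beyond the whole support on one side: the nearest support point w is
   closer than z to every support point, so its potential is at least as large. *)
have mono w : S w -> (forall x, S x -> `|x - w| <= `|x - z|) ->
    (logpot D mu z <= e%:E)%E.
  move=> Sw wz; apply: le_trans (Se w Sw).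
  apply: (ge0_le_integral_carrier mS muS) => //.
  - by move=> x; exact: logker_ge0.
  - by move=> x; exact: logker_ge0.
  - exact: measurable_logkerl.
  - exact: measurable_logkerl.
  - by move=> x Sx; apply: logker_dist_le; exact: wz.
pose L := S `&` [set x | x <= z]; pose U := S `&` [set x | z <= x].
have SLU x : S x -> L x \/ U x.
  by move=> Sx; have [h|h] := leP x z; [left|right; split => //=; exact: ltW].
(* The supremum of the support below z and the infimum above z are the ends of the gap around z;
   both lie in [S] because [S] is closed. *)
have lS : L !=set0 -> exists u, [/\ S u, u < z & forall x, L x -> x <= u].
  move=> L0; have uL : has_ubound L by exists z => x [].
  have [Su uz] : L (sup L).
    by apply: closed_sup => //; apply: closedI => //; exact: closed_le.
  exists (sup L); split => //; last by move=> x Lx; exact: ub_le_sup.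
  by rewrite lt_neqAle uz andbT; apply/eqP => E; apply: Sz; rewrite -E.
have uS : U !=set0 -> exists v, [/\ S v, z < v & forall x, U x -> v <= x].
  move=> U0; have lU : has_lbound U by exists z => x [].
  have [Sv zv] : U (inf U).
    by apply: closed_inf => //; apply: closedI => //; exact: closed_ge.
  exists (inf U); split => //; last by move=> x Ux; exact: ge_inf.
  by rewrite lt_neqAle zv andbT; apply/eqP => E; apply: Sz; rewrite E.
have [/lS[u [Su uz Lu]]|L0] := pselect (L !=set0); last first.
  have [/uS[v [Sv zv Uv]]|U0] := pselect (U !=set0); last first.
    have S0 : S = set0.
      rewrite -subset0 => x /SLU[h|h]; [apply: L0|apply: U0]; by exists x.
    by move: muS; rewrite S0 measure0 => /eqP; rewrite eq_sym onee_eq0.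
  apply: (mono v Sv) => x /SLU[Lx|Ux]; first by exfalso; apply: L0; exists x.
  by have := Uv x Ux => vx; rewrite !ger0_norm; lra.
have [/uS[v [Sv zv Uv]]|U0] := pselect (U !=set0); last first.
  apply: (mono u Su) => x /SLU[Lx|Ux]; last by exfalso; apply: U0; exists x.
  by have := Lu x Lx => xu; rewrite !ler0_norm; lra.
pose t := (v - z) / (v - u).
have vu0 : 0 < v - u by lra.
have t0 : 0 < t by rewrite divr_gt0//; lra.
have t1 : t < 1 by rewrite ltr_pdivrMr//; lra.
have zE : z = t * u + (1 - t) * v.
  by rewrite /t; field; rewrite gt_eqF.
have nn s y : 0 < s -> forall x, (0 <= s%:E * logker D x y)%E.
  by move=> s0 x; rewrite mule_ge0 ?logker_ge0// lee_fin ltW.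
have t1' : 0 < 1 - t by lra.
have mk s y : measurable_fun setT
    (fun x : measurableTypeR R => (s%:E * logker D x y)%E).
  by apply: measurable_funeM; exact: measurable_logkerl.
apply: (@le_trans _ _ (\int[mu]_x (t%:E * logker D x u +
                                   (1 - t)%:E * logker D x v))%E).
  apply: (ge0_le_integral_carrier mS muS) => //.
  - by move=> x; exact: logker_ge0.
  - by move=> x; rewrite adde_ge0 ?nn.
  - exact: measurable_logkerl.
  - by apply: emeasurable_funD; exact: mk.
  - move=> x Sx; rewrite [in leLHS]zE; apply: logker_convex => //; first lra.
    by case: (SLU x Sx) => [/Lu|/Uv]; [left|right].
rewrite ge0_integralD//; [|by move=> x _; exact: nn..].
have pull s y : 0 < s ->
    (\int[mu]_x (s%:E * logker D x y) = s%:E * logpot D mu y)%E.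
  move=> s0; rewrite ge0_integralZl_EFin ?ltW//.
  - by move=> x _; exact: logker_ge0.
  - exact: measurable_logkerl.
rewrite !pull//; apply: (@le_trans _ _ (t%:E * e%:E + (1 - t)%:E * e%:E)%E).
  by apply: leeD; (apply: lee_wpmul2l; [rewrite lee_fin ltW|]); rewrite ?Se.
by rewrite -!EFinM -EFinD lee_fin; lra.
Qed.

(** * Lower bound for the norms of monic polynomials *)

Section factorization.
Import complex.
Local Open Scope complex_scope.

(** The witnesses are the real parts of the complex roots: for real x, |x - z| is at least |x - Re
    z|. *)
Lemma monic_horner_ge_prod (R : rcfType) (n : nat) (p : {poly R}) :
  p \is monic -> size p = n.+1 ->
  exists2 s : seq R, size s = n &
    forall x, \prod_(a <- s) `|x - a| <= `|p.[x]|.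
Proof.
move=> pm psz; pose q : {poly R[i]} := map_poly (real_complex R) p.
have [r] := closed_field_poly_normal q.
have -> : lead_coef q = 1.
  by rewrite lead_coef_map (eqP pm) rmorph1.
rewrite scale1r => qE.
exists [seq complex.Re z | z <- r].
  apply: succn_inj; rewrite size_map -psz -(size_map_poly (real_complex R)) -/q.
  by rewrite qE size_prod_XsubC.
have normC (y : R) : `|y%:C| = `|y|%:C.
  by rewrite normc_def /= expr0n /= addr0 sqrtr_sqr.
move=> x; rewrite -lecR -normC.
have -> : (p.[x])%:C = q.[x%:C] by rewrite /q horner_map.
rewrite qE horner_prod normr_prod big_map rmorph_prod /=.
apply: ler_prod => z _; rewrite hornerXsubC -normC normr_ge0 /=.
have := normc_ge_Re (x%:C - z); rewrite -normC.
by case: z => a b.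
Qed.

End factorization.

(** * Capacity and energy of the equilibrium measure *)

Lemma Cap_equilibrium (R : realType) (K : set R) (mu : borel_probability R) :
  is_equilibrium_measure K mu -> Cap K = fine (expeR (- log_energy mu)).
Proof.
move=> [muK mu_min]; rewrite /Cap; congr (fine (expeR (- _))).
apply/eqP; rewrite eq_le; apply/andP; split.
  by apply: ge_ereal_inf; exists (log_energy mu) => //; exists mu.
by apply: le_ereal_inf_tmp => _ [nu nuK <-]; exact: mu_min.
Qed.

(** A competitor carried by the support is also carried by [K], so [mu] is an equilibrium measure of
    its own support too, and both capacities are read off from the same energy. *)
Lemma Cap_measure_support (R : realType) (K : set R)
    (mu : borel_probability R) :
  compact K -> is_equilibrium_measure K mu ->
  Cap (measure_support mu) = Cap K.
Proof.
move=> cK muK; rewrite (Cap_equilibrium muK); apply: Cap_equilibrium.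
split; first exact: measure_support1.
move=> nu nuS; apply: muK.2; apply/eqP.
rewrite eq_le probability_le1 /=; last first.
  exact: closed_measurable (compact_closed (@Rhausdorff R) cK).
have clK := compact_closed (@Rhausdorff R) cK.
rewrite -nuS; apply: le_measure; rewrite ?inE.
- exact: measurable_measure_support.
- exact: closed_measurable.
- exact: measure_support_sub clK muK.1.
Qed.

Lemma nonpolar_energy (R : realType) (K : set R) (mu : borel_probability R) :
  nonpolar K -> is_equilibrium_measure K mu ->
  exists2 E : R, log_energy mu = E%:E & Cap K = expR (- E).
Proof.
rewrite /nonpolar => + muK; rewrite (Cap_equilibrium muK).
(* Either infinite energy gives capacity 0: [expeR] is 0 at -oo, and at +oo it is +oo, which [fine]
   sends to 0. *)
by case: (log_energy mu) => [E _||] /=; [exists E|rewrite ltxx..].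
Qed.

Lemma compact_diameter (R : realType) (K : set R) : compact K ->
  exists2 D : R, 1 <= D & forall x y, K x -> K y -> `|x - y| <= D.
Proof.
move=> /compact_bounded[B [_ KB]].
have M x : K x -> `|x| <= `|B| + 1.
  by apply: KB; rewrite (le_lt_trans (ler_norm B))// ltrDl.
exists (`|B| + 1 + (`|B| + 1)); first by have := normr_ge0 B; lra.
move=> x y Kx Ky; rewrite (le_trans (ler_normB _ _))//.
by apply: lerD; exact: M.
Qed.

Lemma equilibrium_logpot_le (R : realType) (K : set R)
    (mu : borel_probability R) (E D : R) :
  measurable (K : set (measurableTypeR R)) -> is_equilibrium_measure K mu ->
  log_energy mu = E%:E -> 1 <= D ->
  (forall x y, K x -> K y -> `|x - y| <= D) ->
  forall z, (logpot D mu z <= (E + ln D)%:E)%E.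
Proof.
move=> mK [muK mu_min] EE D1 KD; apply: logpot_le_line => z.
have pot (nu : borel_probability R) : nu K = 1%E ->
    (\int[nu]_y logpot D nu y = log_energy nu + (ln D)%:E)%E.
  by move=> nuK; rewrite (log_energy_logpot D1 mK nuK KD) subeK.
apply: (logpot_le_support mK muK); first by rewrite pot// EE.
by move=> nu nuK; rewrite pot// EFinD leeD2r// -EE mu_min.
Qed.

(** * From the potential bound to a lower bound on L^2 norms *)

Lemma sum_logker_ge (R : realType) (D x : R) (s : seq R) :
  0 < \prod_(a <- s) `|x - a| ->
  ((\sum_(a <- s) ln D - ln (\prod_(a <- s) `|x - a|))%:E
    <= \sum_(a <- s) logker D x a)%E.
Proof.
elim: s => [|a s IH]; first by rewrite !big_nil ln1 subrr.
rewrite !big_cons => h.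
have a0 : 0 < `|x - a|.
  rewrite lt_neqAle normr_ge0 andbT eq_sym.
  by apply/eqP => a0; move: h; rewrite a0 mul0r ltxx.
have s0 : 0 < \prod_(b <- s) `|x - b| by move: h; rewrite pmulr_rgt0.
rewrite lnM ?posrE// opprD addrACA EFinD leeD ?IH//.
rewrite /logker ifF ?lee_fin ?le_max ?lexx//.
by apply/negbTE; rewrite -subr_eq0 -normr_eq0 gt_eqF.
Qed.

Lemma sum_logker_pinfty (R : realType) (D x : R) (s : seq R) :
  \prod_(a <- s) `|x - a| = 0 -> (\sum_(a <- s) logker D x a = +oo)%E.
Proof.
elim: s => [|a s IH]; first by rewrite big_nil => /eqP; rewrite oner_eq0.
have nn : (\sum_(b <- s) logker D x b != -oo)%E.
  by rewrite gt_eqF// (@lt_le_trans _ _ 0%E)// sume_ge0// => *;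
    exact: logker_ge0.
rewrite !big_cons => /eqP; rewrite mulf_eq0 => /orP[|/eqP/IH ->].
  by rewrite normr_eq0 subr_eq0 {1}/logker => ->; rewrite addye.
by rewrite addey// gt_eqF// (@lt_le_trans _ _ 0%E)// logker_ge0.
Qed.

Lemma measurable_horner_sqr (R : realType) (p : {poly R}) :
  measurable_fun setT (fun x : measurableTypeR R => p.[x] ^+ 2).
Proof.
apply: measurable_funX; apply: continuous_measurable_fun.
exact: continuous_horner.
Qed.

(* Jensen's inequality in the form [ln t <= t - 1], with
   [t = p ^ 2 / Cap ^ (2 n)]. *)
Lemma integral_horner_sqr_ge (R : realType) (mu : borel_probability R)
    (D E : R) (n : nat) (p : {poly R}) :
  (forall z, (logpot D mu z <= (E + ln D)%:E)%E) -> monic_of_degree n p ->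
  (((expR (- E) ^+ n) ^+ 2)%:E <= \int[mu]_x (p.[x] ^+ 2)%:E)%E.
Proof.
move=> Ule [pm psz]; have [s ss sp] := monic_horner_ge_prod pm psz.
set c := (expR (- E) ^+ n) ^+ 2.
have c0 : 0 < c by rewrite !exprn_gt0 ?expR_gt0.
have lnc : ln c = - (E *+ n) *+ 2.
  by rewrite /c !lnXn ?exprn_gt0 ?expR_gt0// expRK mulNrn.
pose S x := (\sum_(a <- s) logker D x a)%E.
have mS : measurable_fun setT (S : measurableTypeR R -> \bar R).
  by apply: emeasurable_sum => a; exact: measurable_logkerl.
have S0 x : (0 <= S x)%E by apply: sume_ge0 => a _; exact: logker_ge0.
have mp : measurable_fun setT
    (fun x : measurableTypeR R => (c^-1 * p.[x] ^+ 2)%:E).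
  apply/measurable_EFinP; apply: measurable_funM => //.
  exact: measurable_horner_sqr.
have p0 x : (0 <= (c^-1 * p.[x] ^+ 2)%:E)%E.
  by rewrite lee_fin mulr_ge0 ?sqr_ge0// invr_ge0 ltW.
(* With w the product of the |x - a|, ln t <= t - 1 at t = w^2 / c gives 2 n E + 2 ln w <= p(x)^2 /
   c - 1, and ln w >= n ln D - S(x). At a zero of w the right side is +oo. *)
have pointwise x :
    ((1 + ((E + ln D) *+ n) *+ 2)%:E
      <= (c^-1 * p.[x] ^+ 2)%:E + 2%:E * S x)%E.
  have [P0|P0] := eqVneq (\prod_(a <- s) `|x - a|) 0.
    by rewrite /S sum_logker_pinfty// gt0_muley ?lte_fin// addey ?leey.
  have {}P0 : 0 < \prod_(a <- s) `|x - a|.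
    by rewrite lt_neqAle eq_sym P0 prodr_ge0// => a _; rewrite normr_ge0.
  have := sum_logker_ge D P0; rewrite -/(S x).
  rewrite big_const_seq count_predT ss iter_addr_0.
  have := sp x; move: P0; move: (\prod_(a <- s) _) => w w0 wp.
  have wc0 : 0 < c^-1 * w ^+ 2 by rewrite mulr_gt0 ?invr_gt0// exprn_gt0.
  have : c^-1 * w ^+ 2 <= c^-1 * p.[x] ^+ 2.
    rewrite ler_pM2l ?invr_gt0// -[leRHS]real_normK ?num_real//.
    by rewrite ler_sqr ?nnegrE// ltW.
  have : ln (c^-1 * w ^+ 2) <= c^-1 * w ^+ 2 - 1.
    rewrite -[X in ln X](subrK 1) addrC le_ln1Dx//; lra.
  rewrite lnM ?posrE ?invr_gt0 ?exprn_gt0 ?expR_gt0//.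
  rewrite (@lnV _ c) ?posrE// lnc lnXn//.
  case: (S x) => [t||]//; last by rewrite gt0_muley ?lte_fin// addey ?leey.
  rewrite -[(_ + 2%:E * t%:E)%E]/((c^-1 * p.[x] ^+ 2 + 2 * t)%:E) !lee_fin.
  rewrite mulrnDl !(mulr2n (_ : R)).
  move: (ln D *+ n) (E *+ n) (c^-1 * _) (c^-1 * _) (ln w) => A B q1 q2 l.
  lra.
have intS : (\int[mu]_x S x <= ((E + ln D) *+ n)%:E)%E.
  rewrite ge0_integral_sum//.
  - rewrite (@le_trans _ _ (\sum_(a <- s) (E + ln D)%:E)%E)//.
      by apply: lee_sum => a _; exact: Ule.
    by rewrite sumEFin big_const_seq count_predT ss iter_addr_0.
  - by move=> a; exact: measurable_logkerl.
  - by move=> a x _; exact: logker_ge0.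
have : ((1 + ((E + ln D) *+ n) *+ 2)%:E
    <= \int[mu]_x ((c^-1 * p.[x] ^+ 2)%:E + 2%:E * S x))%E.
  have mg : measurable_fun setT (fun x : measurableTypeR R =>
      ((c^-1 * p.[x] ^+ 2)%:E + 2%:E * S x)%E).
    by apply: emeasurable_funD => //; exact: measurable_funeM.
  (* Monotonicity of the integral is used for nonnegative functions; a negative constant is below
     the integral anyway. *)
  have [k0|k0] := leP 0 (1 + ((E + ln D) *+ n) *+ 2).
    rewrite -[leLHS](integral_probability_cst mu).
    apply: ge0_le_integral => //.
  rewrite (@le_trans _ _ 0%E)//; first by rewrite lee_fin ltW.
  by apply: integral_ge0 => x _; rewrite adde_ge0// mule_ge0// lee_fin.
rewrite ge0_integralD//; first last.
- exact: measurable_funeM.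
- by move=> x _; rewrite mule_ge0// lee_fin.
rewrite (ge0_integralZl_EFin mu measurableT)//.
under eq_integral do rewrite EFinM.
rewrite ge0_integralZl_EFin ?invr_ge0 ?(ltW c0)//; first last.
- by apply/measurable_EFinP; exact: measurable_horner_sqr.
- by move=> x _; rewrite lee_fin sqr_ge0.
(* The integral of [S] is finite and at most n (E + ln D), so subtracting its double cancels all but
   the 1 on the left. *)
have [r Sr] : exists r : R, (\int[mu]_x S x = r%:E)%E.
  by apply: ge0_le_EFin intS; apply: integral_ge0 => x _; exact: S0.
move: intS; rewrite Sr lee_fin => rn.
have : (0 <= \int[mu]_x (p.[x] ^+ 2)%:E)%E.
  by apply: integral_ge0 => x _; rewrite lee_fin sqr_ge0.
case: (integral _ _ _) => [v||]//; last by move=> _ _; exact: leey.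
rewrite -[(_ + 2%:E * r%:E)%E]/((c^-1 * v + 2 * r)%:E) !lee_fin !mulr2n.
move=> v0 key.
have : 1 <= c^-1 * v by lra.
by rewrite mulrC ler_pdivlMr// mul1r.
Qed.

(** * Orthogonal polynomials *)

Lemma quadratic_nonneg_linear0 (R : realFieldType) (b c : R) :
  0 <= c -> (forall t, 0 <= 2 * t * b + t ^+ 2 * c) -> b = 0.
Proof.
move=> c0 h; have c1 : 0 < c + 1 by lra.
(* The minimizer would be -b / c; the denominator c + 1 also serves c = 0, and the quadratic becomes
   -t^2 (c + 2) at this t. *)
have := h (- b / (c + 1)); set t := - b / (c + 1).
have tE : b = - (t * (c + 1)) by rewrite /t; field; rewrite gt_eqF.
move=> ht; have t2 : t ^+ 2 * (c + 2) <= 0.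
  by move: ht; rewrite {1}tE; nra.
have : t ^+ 2 <= 0 by rewrite -(pmulr_lle0 _ (_ : 0 < c + 2)) //; lra.
by move=> ht2; rewrite tE (_ : t = 0) ?mul0r ?oppr0//; apply/eqP;
  rewrite -sqrf_eq0 eq_le ht2 sqr_ge0.
Qed.

(** * Polynomial integrals against a probability measure on a compact set *)

Section polynomial_integrals.
Context (R : realType).
Variables (mu : borel_probability R) (K : set R).
Hypothesis cK : compact K.
Hypothesis muK : mu K = 1%E.

Let mK : measurable (K : set (measurableTypeR R)).
Proof. exact: closed_measurable (compact_closed (@Rhausdorff R) cK). Qed.

Lemma supnorm_on_ubound (p : {poly R}) x : K x -> `|p.[x]| <= supnorm_on K p.
Proof.
move=> Kx; apply: ub_le_sup; last by exists x.
have cpK : compact (horner p @` K).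
  by apply: continuous_compact => //; apply: continuous_subspaceT;
    exact: continuous_horner.
have [B [_ hB]] := compact_bounded cpK.
exists (`|B| + 1) => _ [y Ky <-].
by apply: hB; [rewrite (le_lt_trans (ler_norm B))// ltrDl|exists y].
Qed.

Lemma carrier_nonempty : K !=set0.
Proof.
apply/set0P/eqP => K0; move: muK; rewrite K0 measure0 => /eqP.
by rewrite eq_sym onee_eq0.
Qed.

Lemma measurable_horner (p : {poly R}) :
  measurable_fun setT (horner p : measurableTypeR R -> R).
Proof. by apply: continuous_measurable_fun; exact: continuous_horner. Qed.

Lemma integrable_horner (p : {poly R}) :
  mu.-integrable setT (EFin \o (horner p : measurableTypeR R -> R)).
Proof.
have mp := measurable_horner p.
apply/integrableP; split; first exact/measurable_EFinP.
apply: (@le_lt_trans _ _ (supnorm_on K p)%:E); last exact: ltry.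
rewrite -(integral_probability_cst mu).
have [y Ky] := carrier_nonempty.
have s0 := le_trans (normr_ge0 _) (supnorm_on_ubound p Ky).
apply: (ge0_le_integral_carrier mK muK) => //.
- by do 2 apply: measurableT_comp => //.
- by move=> x Kx; rewrite /= lee_fin supnorm_on_ubound.
Qed.

Definition pint (p : {poly R}) : R := (\int[mu]_x p.[x])%R.

Lemma pintE p : (\int[mu]_x (p.[x])%:E = (pint p)%:E)%E.
Proof.
by rewrite /pint /Rintegral fineK//; apply: integrable_fin_num => //;
  exact: integrable_horner.
Qed.

Lemma pintD p q : pint (p + q) = pint p + pint q.
Proof.
rewrite /pint -RintegralD//; [|exact: integrable_horner..].
by apply: eq_Rintegral => x _; rewrite hornerD.
Qed.

Lemma pintZ c p : pint (c *: p) = c * pint p.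
Proof.
rewrite /pint -RintegralZl//; last exact: integrable_horner.
by apply: eq_Rintegral => x _; rewrite hornerZ.
Qed.

Lemma pint_sqr_ge0 p : 0 <= pint (p ^+ 2).
Proof. by apply: Rintegral_ge0 => x _; rewrite horner_exp sqr_ge0. Qed.

Lemma L2normE p : L2norm mu p = (Num.sqrt (pint (p ^+ 2)))%:E.
Proof.
rewrite /L2norm unlock.
have -> : (\int[mu]_x (`|(EFin \o horner p) x| `^ 2) = (pint (p ^+ 2))%:E)%E.
  rewrite -pintE; apply: eq_integral => x _.
  rewrite /= powR_mulrn ?normr_ge0// horner_exp.
  by rewrite real_normK ?num_real.
by rewrite poweR_EFin powR12_sqrt ?pint_sqr_ge0.
Qed.

Lemma L2norm_le_supnorm p : Num.sqrt (pint (p ^+ 2)) <= supnorm_on K p.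
Proof.
have [y Ky] := carrier_nonempty.
have s0 := le_trans (normr_ge0 _) (supnorm_on_ubound p Ky).
rewrite -[leRHS]ger0_norm// -sqrtr_sqr ler_wsqrtr// -lee_fin -pintE.
rewrite -(integral_probability_cst mu).
apply: (ge0_le_integral_carrier mK muK) => //.
- by move=> x; rewrite lee_fin horner_exp sqr_ge0.
- by move=> x; rewrite lee_fin sqr_ge0.
- by apply/measurable_EFinP; exact: measurable_horner.
- move=> x Kx; rewrite lee_fin horner_exp -[leLHS]real_normK ?num_real//.
  by rewrite ler_sqr ?nnegrE// supnorm_on_ubound.
Qed.

Lemma orthogonal_poly_min n p q : is_orthogonal_poly mu n p ->
  monic_of_degree n q -> pint (p ^+ 2) <= pint (q ^+ 2).
Proof.
move=> [_ pmin] /pmin; rewrite !L2normE lee_fin.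
by rewrite ler_sqrt// pint_sqr_ge0.
Qed.

(** For every real t the polynomial p + t q is still monic of degree n, so minimality of p makes the
    increment 2 t <p, q> + t^2 <q, q> nonnegative, which forces <p, q> = 0. *)
Lemma orthogonal_poly_pint0 n (p q : {poly R}) : is_orthogonal_poly mu n p ->
  (size q <= n)%N -> pint (p * q) = 0.
Proof.
move=> po qn; have [[pm psz] _] := po.
apply: (quadratic_nonneg_linear0 (pint_sqr_ge0 q)) => t.
have tq : (size (t *: q) < size p)%N.
  by rewrite psz ltnS (leq_trans (size_scale_leq _ _)).
have : monic_of_degree n (p + t *: q).
  by split; [rewrite monicE lead_coefDl// (eqP pm)|rewrite size_polyDl].
move=> /(orthogonal_poly_min po).
have -> : (p + t *: q) ^+ 2 = p ^+ 2 + (2 * t) *: (p * q) + t ^+ 2 *: q ^+ 2.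
  by rewrite -!mul_polyC polyCM polyC_exp polyC_natr; ring.
by rewrite !pintD !pintZ -addrA lerDl.
Qed.

(** Pair the recurrence for P_{n+2} with P_n: the left side vanishes by orthogonality, and <x
    P_{n+1}, P_n> = ||P_{n+1}||^2 because x P_n - P_{n+1} has degree at most n. *)
Lemma orthogonal_poly_norm_rec (P : nat -> {poly R}) (a b : nat -> R) n :
  (forall n, is_orthogonal_poly mu n (P n)) -> is_recurrence_coeffs P a b ->
  pint (P n.+1 ^+ 2) = a n.+1 ^+ 2 * pint (P n ^+ 2).
Proof.
move=> Po [_ /(_ n.+1) /= rec].
have [[Bm Bs] _] := Po n; have [[Am As] _] := Po n.+1.
have CB : pint (P n.+2 * P n) = 0.
  by apply: (orthogonal_poly_pint0 (Po _)); rewrite Bs.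
have AB : pint (P n.+1 * P n) = 0.
  by apply: (orthogonal_poly_pint0 (Po _)); rewrite Bs.
have AXB : pint (P n.+1 * ('X * P n - P n.+1)) = 0.
  apply: (orthogonal_poly_pint0 (Po _)).
  have XBs : size ('X * P n) = n.+2.
    by rewrite mulrC size_mulX ?Bs// -size_poly_eq0 Bs.
  have sz : (size ('X * P n - P n.+1)%R <= n.+2)%N.
    by rewrite (leq_trans (size_polyD _ _))// size_polyN XBs As maxnn.
  (* The generic size bound is one too large; at index n + 1 the two leading coefficients 1
     cancel. *)
  apply/leq_sizeP => j; rewrite leq_eqVlt => /predU1P[<-|nj]; last first.
    by move/leq_sizeP: sz; exact.
  rewrite coefB coefXM /=; move: (eqP Am) (eqP Bm).
  by rewrite !lead_coefE As Bs /= => -> ->; rewrite subrr.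
move: CB; rewrite rec.
have -> : (('X - (b n.+2)%:P) * P n.+1 - a n.+1 ^+ 2 *: P n) * P n
  = P n.+1 * ('X * P n - P n.+1) + P n.+1 ^+ 2
    + (- b n.+2) *: (P n.+1 * P n) + (- a n.+1 ^+ 2) *: P n ^+ 2.
  by rewrite -!mul_polyC !polyCN; ring.
rewrite !pintD !pintZ AXB AB => h.
by apply/eqP; rewrite -subr_eq0; apply/eqP; lra.
Qed.

End polynomial_integrals.

(** * Unboundedness of both sequences *)

Lemma limn_einf_ge (R : realType) (u : nat -> \bar R) (c : \bar R) (N : nat) :
  (forall n, (N <= n)%N -> (c <= u n)%E) -> (c <= limn_einf u)%E.
Proof.
move=> cu; rewrite limn_einf_lim (cvg_lim _ (@cvg_einfs_sup _ u))//.
apply: (@le_trans _ _ (einfs u N)); last by apply: ereal_sup_ubound; exists N.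
by apply: le_ereal_inf_tmp => _ [n /= Nn <-]; exact: cu.
Qed.

Lemma bounded_natP (R : realType) (f : nat -> R) (A : set nat) :
  [bounded f n | n in A] -> exists2 B : R, 0 < B & forall n, A n -> f n <= B.
Proof.
move=> [B [_ hB]]; exists (`|B| + 1); first by rewrite ltr_wpDl.
move=> n An; apply: le_trans (ler_norm _) _.
by apply: hB => //; rewrite (le_lt_trans (ler_norm B))// ltrDl.
Qed.

Unset Implicit Arguments.

Theorem corollary1p5 (R : realType) (K : set R)
    (K_compact : compact K) (K_nonpolar : nonpolar K)
    (muK : borel_probability R) (muK_eq : is_equilibrium_measure K muK)
    (P : nat -> {poly R}) (P_orth : forall n, is_orthogonal_poly muK n (P n))
    (a b : nat -> R) (ab_rec : is_recurrence_coeffs P a b)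
    (T : nat -> {poly R})
    (T_cheb : forall n, (0 < n)%N -> is_chebyshev_poly K n (T n)) :
  limn_einf (fun n => (a n)%:E) = 0%E ->
  ~ [bounded W muK P n | n in [set n : nat | (0 < n)%N]] /\
  ~ [bounded M K T n | n in [set n : nat | (0 < n)%N]].
Proof.
have clK : closed K := compact_closed (@Rhausdorff R) K_compact.
have mK : measurable (K : set (measurableTypeR R)) by exact: closed_measurable.
have muK1 := muK_eq.1.
have [E EE CapE] := nonpolar_energy K_nonpolar muK_eq.
have [D D1 KD] := compact_diameter K_compact.
have Ule := equilibrium_logpot_le mK muK_eq EE D1 KD.
have C0 : 0 < Cap K := K_nonpolar.
have CapS := Cap_measure_support K_compact muK_eq.
pose N n := Num.sqrt (pint muK (P n ^+ 2)).
have WE n : W muK P n = N n / Cap K ^+ n.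
  by rewrite /W CapS (L2normE K_compact muK1).
have N_ge n : Cap K ^+ n <= N n.
  rewrite /N -[leLHS]ger0_norm ?exprn_ge0 ?(ltW C0)// -sqrtr_sqr ler_wsqrtr//.
  rewrite -lee_fin -(pintE K_compact muK1) CapE.
  have := integral_horner_sqr_ge Ule (P_orth n).1.
  by under eq_integral do rewrite -horner_exp.
have N_rec n : N n.+1 = a n.+1 * N n.
  rewrite /N (orthogonal_poly_norm_rec K_compact muK1 _ P_orth ab_rec).
  by rewrite sqrtrM ?sqr_ge0// sqrtr_sqr ger0_norm// ltW// ab_rec.1.
(* If W_{n+1} <= B, then Cap^(n+2) <= N_{n+2} = a_{n+2} N_{n+1} <= a_{n+2} B Cap^(n+1), so a_{n+2}
   >= Cap / B > 0, against liminf a_n = 0. *)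
move=> a0; have unboundedW B : 0 < B -> ~ forall n, (0 < n)%N -> W muK P n <= B.
  move=> B0 WB; have : ((Cap K / B)%:E <= limn_einf (fun n => (a n)%:E))%E.
    (* The bound on a_m uses W_{m-1}, and W is bounded only at positive indices, hence the start at
       m = 2. *)
    apply: (@limn_einf_ge _ _ _ 2) => -[|[|n]]// _.
    rewrite lee_fin ler_pdivrMr//.
    have := WB n.+1 isT; rewrite WE ler_pdivrMr ?exprn_gt0// => NB.
    have := N_ge n.+2; rewrite N_rec exprS => Na.
    have an : 0 < a n.+2 by exact: ab_rec.1.
    rewrite -(ler_pM2r (exprn_gt0 n.+1 C0)) (le_trans Na)// -mulrA.
    by rewrite ler_pM2l.
  by rewrite a0 lee_fin leNgt divr_gt0.
split; first by move=> /bounded_natP[B B0 WB]; exact: (unboundedW B B0 WB).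
(* A bound on M bounds W: T_n is a monic competitor for P_n, and its L^2 norm is at most its sup
   norm on [K]. *)
move=> /bounded_natP[B B0 MB]; apply: (unboundedW B B0) => n n0.
apply: le_trans (MB n n0); rewrite WE /M ler_pM2r ?invr_gt0 ?exprn_gt0//.
apply: le_trans (L2norm_le_supnorm K_compact muK1 (T n)).
apply: ler_wsqrtr.
exact: (orthogonal_poly_min K_compact muK1 (P_orth n) (T_cheb n n0).1).
Qed.
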